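(* (Coherence) In the Fitch-style calculus for Intuitionistic S4, interpreted in a cartesian closed category $\mathcal{C}$ with an adjunction $\Diamond\dashv\Box$ in which $\Box$ is an idempotent comonad, any two derivation trees of the same typed term-in-context $\Gamma\vdash t:A$ have equal denotations.
   Context: Calculus: types $A,B ::= p \mid 1 \mid A\times B \mid A\to B \mid \Box A$; contexts $\Gamma ::= \cdot \mid \Gamma,x:A \mid \Gamma,\bullet$ ($\bullet$ a structural symbol called a lock; variables distinct). Rules: (var) $\Gamma,x:A,\Gamma'\vdash x:A$ provided $\Gamma'$ contains no lock; (products) $\Gamma\vdash\langle\rangle:1$, pairing and projections as usual; (functions) $\lambda$-abstraction and application as usual; (shut) from $\Gamma,\bullet\vdash t:A$ infer $\Gamma\vdash\mathrm{shut}\,t:\Box A$; (open) from $\Gamma\vdash t:\Box A$ infer $\Gamma,\Gamma'\vdash\mathrm{open}\,t:A$ for any context $\Gamma'$ (the term does not record $\Gamma'$, so a term may have several derivations). Semantics: $(\Diamond,\eta,\mu)$ is the monad induced by the comonad $\Box$ via the adjunction (unit $\eta^m$, counit $\varepsilon^m$); idempotence means each $\mu_X$ is an isomorphism with inverse $\eta_{\Diamond X}=\Diamond\eta_X$. Types are interpreted via the cartesian closed structure and $\Box$ (atoms by arbitrary objects). A context $\Gamma$ denotes an endofunctor: $[\![\cdot]\!]=\mathrm{Id}$, $[\![\Gamma,x:A]\!](X)=[\![\Gamma]\!](X)\times[\![A]\!]$, $[\![\Gamma,\bullet]\!](X)=\Diamond[\![\Gamma]\!](X)$, and the object $[\![\Gamma]\!]=[\![\Gamma]\!](1)$,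 so $[\![\Gamma,\Gamma']\!]=[\![\Gamma']\!]([\![\Gamma]\!])$. Lock replacement $l_\Gamma:[\![\Gamma]\!]\Rightarrow\Diamond$: $l_\cdot=\eta$, $(l_{\Gamma,x:A})_X=(l_\Gamma)_X\circ\mathrm{pr}$, $(l_{\Gamma,\bullet})_X=\mu_X\circ\Diamond(l_\Gamma)_X$. A derivation $D$ of $\Gamma\vdash t:A$ denotes $[\![D]\!]:[\![\Gamma]\!]\to[\![A]\!]$ by induction on $D$: variables by projections, $1,\times,\to$ by the cartesian closed structure, $[\![\mathrm{shut}\,t]\!]=\Box[\![t]\!]\circ\eta^m_{[\![\Gamma]\!]}$, and $[\![\Gamma,\Gamma'\vdash\mathrm{open}\,t]\!]=\varepsilon^m_{[\![A]\!]}\circ\Diamond[\![t]\!]\circ(l_{\Gamma'})_{[\![\Gamma]\!]}$. *)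

(* Defs.v *)
(* Vanilla Rocq: only the prelude is needed. *)
Set Implicit Arguments.
Unset Strict Implicit.
Unset Printing Implicit Defensive.

Declare Scope cat_scope.
Delimit Scope cat_scope with cat.

(** * Categories, functors, adjunctions, comonads *)

Record category := Category {
  obj :> Type;
  hom : obj -> obj -> Type;
  idm : forall a, hom a a;
  comp : forall a b c, hom b c -> hom a b -> hom a c;
  comp_idl : forall a b (f : hom a b), comp (idm b) f = f;
  comp_idr : forall a b (f : hom a b), comp f (idm a) = f;
  comp_assoc : forall a b c d (h : hom c d) (g : hom b c) (f : hom a b),
    comp h (comp g f) = comp (comp h g) f
}.
Arguments idm {_} a.

Notation "g \o f" := (comp g f) (at level 50, left associativity) : cat_scope.
Open Scope cat_scope.

Definition is_iso (C : category) (a b : C) (f : hom a b) : Prop :=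
  exists g : hom b a, g \o f = idm a /\ f \o g = idm b.

(* The identity morphism along an equality of objects. *)
Definition idto (C : category) (a b : C) (e : a = b) : hom a b :=
  match e in _ = b' return hom a b' with eq_refl => idm a end.

Record functor (C D : category) := Functor {
  fobj :> C -> D;
  fmap : forall a b, hom a b -> hom (fobj a) (fobj b);
  fmap_id : forall a, fmap (idm a) = idm (fobj a);
  fmap_comp : forall a b c (g : hom b c) (f : hom a b),
    fmap (g \o f) = fmap g \o fmap f
}.
Arguments fmap {_ _} _ {a b} _.

Definition id_functor (C : category) : functor C C :=
  @Functor C C (fun a => a) (fun a b f => f)
    (fun a => eq_refl) (fun a b c g f => eq_refl).

Lemma comp_functor_id (C D E : category) (G : functor D E) (F : functor C D)
  (a : C) : fmap G (fmap F (idm a)) = idm (G (F a)).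
Proof. rewrite fmap_id. apply fmap_id. Qed.

Lemma comp_functor_comp (C D E : category) (G : functor D E) (F : functor C D)
  (a b c : C) (g : hom b c) (f : hom a b) :
  fmap G (fmap F (g \o f)) = fmap G (fmap F g) \o fmap G (fmap F f).
Proof. rewrite fmap_comp. apply fmap_comp. Qed.

Definition comp_functor (C D E : category) (G : functor D E) (F : functor C D) :
  functor C E :=
  @Functor C E (fun a => G (F a)) (fun a b f => fmap G (fmap F f))
    (comp_functor_id G F) (comp_functor_comp G F).

Record nat_trans (C D : category) (F G : functor C D) := NatTrans {
  component :> forall a, hom (F a) (G a);
  naturality : forall a b (f : hom a b),
    component b \o fmap F f = fmap G f \o component a
}.

Record adjunction (C D : category) (L : functor C D) (R : functor D C) :=
  Adjunction {
  adj_unit : nat_trans (id_functor C) (comp_functor R L);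
  adj_counit : nat_trans (comp_functor L R) (id_functor D);
  adj_triangle_l : forall a : C, adj_counit (L a) \o fmap L (adj_unit a) = idm (L a);
  adj_triangle_r : forall b : D, fmap R (adj_counit b) \o adj_unit (R b) = idm (R b)
}.

Record comonad (C : category) (W : functor C C) := Comonad {
  extract : nat_trans W (id_functor C);
  duplicate : nat_trans W (comp_functor W W);
  extract_duplicate : forall a : C, extract (W a) \o duplicate a = idm (W a);
  fmap_extract_duplicate : forall a : C,
    fmap W (extract a) \o duplicate a = idm (W a);
  duplicate_assoc : forall a : C,
    duplicate (W a) \o duplicate a = fmap W (duplicate a) \o duplicate a
}.

Definition idempotent (C : category) (W : functor C C) (w : comonad W) : Prop :=
  forall a : C, is_iso (duplicate w a).

Record cartesian_closed (C : category) := CartesianClosed {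
  one : C;
  bang : forall a, hom a one;
  bang_uniq : forall a (f : hom a one), f = bang a;
  prod : C -> C -> C;
  pr1 : forall a b, hom (prod a b) a;
  pr2 : forall a b, hom (prod a b) b;
  pairing : forall x a b, hom x a -> hom x b -> hom x (prod a b);
  pr1_pairing : forall x a b (f : hom x a) (g : hom x b),
    pr1 a b \o pairing f g = f;
  pr2_pairing : forall x a b (f : hom x a) (g : hom x b),
    pr2 a b \o pairing f g = g;
  pairing_uniq : forall x a b (h : hom x (prod a b)),
    h = pairing (pr1 a b \o h) (pr2 a b \o h);
  (* [exp a b] is the exponential object b^a. *)
  exp : C -> C -> C;
  ev : forall a b, hom (prod (exp a b) a) b;
  curry : forall x a b, hom (prod x a) b -> hom x (exp a b);
  ev_curry : forall x a b (f : hom (prod x a) b),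
    ev a b \o pairing (curry f \o pr1 x a) (pr2 x a) = f;
  curry_uniq : forall x a b (h : hom x (exp a b)),
    h = curry (ev a b \o pairing (h \o pr1 x a) (pr2 x a))
}.
Arguments pr1 {_} _ {a b}.
Arguments pr2 {_} _ {a b}.
Arguments ev {_} _ {a b}.

Section ProdFunctor.
Variables (C : category) (K : cartesian_closed C) (b : C).

Definition prod_map (x y : C) (f : hom x y) : hom (prod K x b) (prod K y b) :=
  pairing K (f \o pr1 K) (pr2 K).

Lemma prod_map_id (x : C) : prod_map (idm x) = idm (prod K x b).
Proof.
unfold prod_map. rewrite comp_idl.
rewrite (pairing_uniq (idm (prod K x b))). now rewrite !comp_idr.
Qed.

Lemma prod_map_comp (x y z : C) (g : hom y z) (f : hom x y) :
  prod_map (g \o f) = prod_map g \o prod_map f.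
Proof.
unfold prod_map. symmetry.
etransitivity; [apply pairing_uniq|].
now rewrite !comp_assoc, pr1_pairing, pr2_pairing, <- comp_assoc, pr1_pairing, comp_assoc,
  pr2_pairing.
Qed.

Definition prod_functor : functor C C :=
  @Functor C C (fun x => prod K x b) prod_map prod_map_id prod_map_comp.
End ProdFunctor.

(** * Syntax *)

Inductive ty (P : Type) :=
| ty_atom (p : P)
| ty_one
| ty_prod (A B : ty P)
| ty_arr (A B : ty P)
| ty_box (A : ty P).
Arguments ty_one {P}.

(* Contexts grow to the right.  Variables are nameless. *)
Inductive ctx (P : Type) :=
| ctx_nil
| ctx_var (Γ : ctx P) (A : ty P)
| ctx_lock (Γ : ctx P).
Arguments ctx_nil {P}.

Fixpoint ctx_app (P : Type) (Γ Γ' : ctx P) : ctx P :=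
  match Γ' with
  | ctx_nil => Γ
  | ctx_var Γ'' A => ctx_var (ctx_app Γ Γ'') A
  | ctx_lock Γ'' => ctx_lock (ctx_app Γ Γ'')
  end.

Fixpoint lockfree (P : Type) (Γ : ctx P) : Prop :=
  match Γ with
  | ctx_nil => True
  | ctx_var Γ' _ => lockfree Γ'
  | ctx_lock _ => False
  end.

Fixpoint nvars (P : Type) (Γ : ctx P) : nat :=
  match Γ with
  | ctx_nil => 0
  | ctx_var Γ' _ => S (nvars Γ')
  | ctx_lock Γ' => nvars Γ'
  end.

(* Terms up to alpha-equivalence, with de Bruijn indices counting the
   variables, but not the locks, to the right of the one referred to.  Terms
   contain no types: in particular [tm_lam] does not record the type of its
   bound variable. *)
Inductive tm :=
| tm_var (n : nat)
| tm_unit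
| tm_pair (t u : tm)
| tm_fst (t : tm)
| tm_snd (t : tm)
| tm_lam (t : tm)
| tm_app (t u : tm)
| tm_shut (t : tm)
| tm_open (t : tm).

(* [shift k c t] adds [k] to the indices that are at least [c]. *)
Fixpoint shift (k c : nat) (t : tm) : tm :=
  match t with
  | tm_var n => tm_var (if Nat.ltb n c then n else n + k)
  | tm_unit => tm_unit
  | tm_pair t u => tm_pair (shift k c t) (shift k c u)
  | tm_fst t => tm_fst (shift k c t)
  | tm_snd t => tm_snd (shift k c t)
  | tm_lam t => tm_lam (shift k (S c) t)
  | tm_app t u => tm_app (shift k c t) (shift k c u)
  | tm_shut t => tm_shut (shift k c t)
  | tm_open t => tm_open (shift k c t)
  end.

Definition lift (k : nat) (t : tm) : tm := shift k 0 t.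

(* In [d_open], [lift (nvars Γ') t] is the nameless form of [t] itself, read in
   the context extended by Γ'. *)
Inductive deriv (P : Type) : ctx P -> tm -> ty P -> Type :=
| d_var Γ A Γ' :
    lockfree Γ' ->
    deriv (ctx_app (ctx_var Γ A) Γ') (tm_var (nvars Γ')) A
| d_unit Γ :
    deriv Γ tm_unit ty_one
| d_pair Γ t u A B :
    deriv Γ t A -> deriv Γ u B -> deriv Γ (tm_pair t u) (ty_prod A B)
| d_fst Γ t A B :
    deriv Γ t (ty_prod A B) -> deriv Γ (tm_fst t) A
| d_snd Γ t A B :
    deriv Γ t (ty_prod A B) -> deriv Γ (tm_snd t) B
| d_lam Γ t A B :
    deriv (ctx_var Γ A) t B -> deriv Γ (tm_lam t) (ty_arr A B)
| d_app Γ t u A B :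
    deriv Γ t (ty_arr A B) -> deriv Γ u A -> deriv Γ (tm_app t u) B
| d_shut Γ t A :
    deriv (ctx_lock Γ) t A -> deriv Γ (tm_shut t) (ty_box A)
| d_open Γ Γ' t A :
    deriv Γ t (ty_box A) ->
    deriv (ctx_app Γ Γ') (tm_open (lift (nvars Γ') t)) A.

(** * Semantics *)

Section Semantics.
Variables (C : category) (K : cartesian_closed C) (dia box : functor C C).
Variables (adj : adjunction dia box) (w : comonad box).
Variables (P : Type) (rho : P -> C).

(* The monad structure on [dia] that is the mate, under [adj], of the comonad
   structure on [box]. *)
Definition dia_eta (X : C) : hom X (dia X) :=
  extract w (dia X) \o adj_unit adj X.

Definition dia_mu (X : C) : hom (dia (dia X)) (dia X) :=
  adj_counit adj (dia X) \o
  fmap dia (adj_counit adj (box (dia X)) \o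
            fmap dia (duplicate w (dia X) \o adj_unit adj X)).

Fixpoint den_ty (A : ty P) : C :=
  match A with
  | ty_atom p => rho p
  | ty_one => one K
  | ty_prod A B => prod K (den_ty A) (den_ty B)
  | ty_arr A B => exp K (den_ty A) (den_ty B)
  | ty_box A => box (den_ty A)
  end.

Fixpoint den_ctx (Γ : ctx P) : functor C C :=
  match Γ with
  | ctx_nil => id_functor C
  | ctx_var Γ A => comp_functor (prod_functor K (den_ty A)) (den_ctx Γ)
  | ctx_lock Γ => comp_functor dia (den_ctx Γ)
  end.

Definition den_ctx_obj (Γ : ctx P) : C := den_ctx Γ (one K).

Fixpoint den_ctx_app (Γ Γ' : ctx P) (X : C) :
  den_ctx (ctx_app Γ Γ') X = den_ctx Γ' (den_ctx Γ X) :=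
  match Γ' with
  | ctx_nil => eq_refl
  | ctx_var Γ'' A => f_equal (prod_functor K (den_ty A)) (den_ctx_app Γ Γ'' X)
  | ctx_lock Γ'' => f_equal dia (den_ctx_app Γ Γ'' X)
  end.

Fixpoint lock_replace (Γ : ctx P) (X : C) : hom (den_ctx Γ X) (dia X) :=
  match Γ with
  | ctx_nil => dia_eta X
  | ctx_var Γ' A => lock_replace Γ' X \o pr1 K
  | ctx_lock Γ' => dia_mu X \o fmap dia (lock_replace Γ' X)
  end.

Fixpoint lockfree_proj (Γ : ctx P) (X : C) :
  lockfree Γ -> hom (den_ctx Γ X) X :=
  match Γ with
  | ctx_nil => fun _ => idm X
  | ctx_var Γ' A => fun h => @lockfree_proj Γ' X h \o pr1 K
  | ctx_lock Γ' => fun h => match h with end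
  end.

Fixpoint den (Γ : ctx P) (t : tm) (A : ty P) (D : deriv Γ t A) :
  hom (den_ctx_obj Γ) (den_ty A) :=
  match D in deriv Γ t A return hom (den_ctx_obj Γ) (den_ty A) with
  | @d_var _ Γ A Γ' h =>
      pr2 K \o lockfree_proj (den_ctx_obj (ctx_var Γ A)) h
        \o idto (den_ctx_app (ctx_var Γ A) Γ' (one K))
  | d_unit Γ => bang K (den_ctx_obj Γ)
  | d_pair D1 D2 => pairing K (den D1) (den D2)
  | d_fst D => pr1 K \o den D
  | d_snd D => pr2 K \o den D
  | d_lam D => curry (den D)
  | d_app D1 D2 => ev K \o pairing K (den D1) (den D2)
  | @d_shut _ Γ _ _ D => fmap box (den D) \o adj_unit adj (den_ctx_obj Γ)
  | @d_open _ Γ Γ' _ A D =>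
      adj_counit adj (den_ty A) \o fmap dia (den D)
        \o lock_replace Γ' (den_ctx_obj Γ)
        \o idto (den_ctx_app Γ Γ' (one K))
  end.

End Semantics.

(* Main.v *)
(* Terms record no types, so two derivations of a term may assign different types
   to a subterm (to the argument of a projection, say), and uniqueness cannot be
   proved by induction on an arbitrary term.  But a typed term has a beta-normal
   form, by reducibility, and beta-reduction transports derivations without
   changing their denotations, so it is enough to treat normal terms, in which
   neutral subterms determine their types.  There the only ambiguity is in
   [open t]: how much of the context is discarded.  Given two choices, [t] is also
   typable in the meet of the two smaller contexts, and its two denotations
   factor through that one along renamings.  The two composites obtained are
   denotations of the same renaming into a locked context, and such renamings
   are coherent because the monad is idempotent. *)

Require Import Defs.
From Stdlib Require Import Arith Lia Eqdep FunctionalExtensionality.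

Set Implicit Arguments.
Unset Strict Implicit.
Unset Printing Implicit Defensive.

(** * Cartesian closed categories *)

Section CartesianClosed.
Variables (C : category) (K : cartesian_closed C).

Lemma pairing_comp (x y a b : C) (f : hom y a) (g : hom y b) (h : hom x y) :
  pairing K f g \o h = pairing K (f \o h) (g \o h).
Proof.
etransitivity; [apply (pairing_uniq (pairing K f g \o h))|].
now rewrite !comp_assoc, pr1_pairing, pr2_pairing.
Qed.

Lemma pairing_eta (a b : C) : pairing K (pr1 K) (pr2 K) = idm (prod K a b).
Proof.
rewrite (pairing_uniq (idm (prod K a b))). now rewrite !comp_idr.
Qed.

Lemma curry_comp (x y a b : C) (f : hom (prod K y a) b) (m : hom x y) :
  curry f \o m = curry (f \o pairing K (m \o pr1 K) (pr2 K)).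
Proof.
etransitivity; [apply (curry_uniq (curry f \o m))|]. f_equal.
symmetry. rewrite <- (ev_curry f) at 1.
now rewrite <- comp_assoc, pairing_comp, <- comp_assoc, pr1_pairing, pr2_pairing,
  comp_assoc.
Qed.

Lemma ev_curry_pairing (x a b : C) (f : hom (prod K x a) b) (u : hom x a) :
  ev K \o pairing K (curry f) u = f \o pairing K (idm x) u.
Proof.
symmetry. rewrite <- (ev_curry f) at 1.
now rewrite <- comp_assoc, pairing_comp, <- comp_assoc, pr1_pairing, pr2_pairing,
  comp_idr.
Qed.

(** With [idto_prod], moves the transport along [den_ctx_app] inside the functors that a lock or a
    variable of the appended context contributes. *)
Lemma idto_fmap (D E : category) (F : functor D E) (a b : D) (e : a = b) :
  idto (f_equal F e) = fmap F (idto e).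
Proof. destruct e. symmetry. apply fmap_id. Qed.

Lemma idto_prod (a b c : C) (e : a = b) :
  idto (f_equal (fun x => prod K x c) e) = pairing K (idto e \o pr1 K) (pr2 K).
Proof. destruct e. simpl. now rewrite comp_idl, pairing_eta. Qed.

End CartesianClosed.

(** * The monad that is the mate of a comonad *)

Section Monad.
Variables (C : category) (dia box : functor C C).
Variables (adj : adjunction dia box) (w : comonad box).

Local Notation eta := (dia_eta adj w).
Local Notation mu := (dia_mu adj w).
Local Notation "F ◃ f" := (fmap F f) (at level 30, right associativity).

(* The components of the structure maps, retyped so that no composite functor
   occurs in their types: rewriting is up to syntactic equality of the objects
   involved. *)
Definition unit_at (X : C) : hom X (box (dia X)) := adj_unit adj X.
Definition counit_at (X : C) : hom (dia (box X)) X := adj_counit adj X.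
Definition extract_at (X : C) : hom (box X) X := extract w X.
Definition duplicate_at (X : C) : hom (box X) (box (box X)) := duplicate w X.

Lemma unit_nat (X Y : C) (f : hom X Y) :
  box ◃ dia ◃ f \o unit_at X = unit_at Y \o f.
Proof. symmetry. apply (naturality (adj_unit adj) f). Qed.

Lemma counit_nat (X Y : C) (f : hom X Y) :
  counit_at Y \o dia ◃ box ◃ f = f \o counit_at X.
Proof. apply (naturality (adj_counit adj) f). Qed.

Lemma extract_nat (X Y : C) (f : hom X Y) :
  extract_at Y \o box ◃ f = f \o extract_at X.
Proof. apply (naturality (extract w) f). Qed.

Lemma duplicate_nat (X Y : C) (f : hom X Y) :
  duplicate_at Y \o box ◃ f = box ◃ box ◃ f \o duplicate_at X.
Proof. apply (naturality (duplicate w) f). Qed.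

Lemma triangle_l (X : C) : counit_at (dia X) \o dia ◃ unit_at X = idm (dia X).
Proof. apply (adj_triangle_l adj). Qed.

Lemma triangle_r (X : C) : box ◃ counit_at X \o unit_at (box X) = idm (box X).
Proof. apply (adj_triangle_r adj). Qed.

Lemma extract_at_duplicate (X : C) :
  extract_at (box X) \o duplicate_at X = idm (box X).
Proof. apply extract_duplicate. Qed.

Lemma fmap_extract_at_duplicate (X : C) :
  box ◃ extract_at X \o duplicate_at X = idm (box X).
Proof. apply fmap_extract_duplicate. Qed.

Lemma duplicate_at_assoc (X : C) :
  duplicate_at (box X) \o duplicate_at X = box ◃ duplicate_at X \o duplicate_at X.
Proof. apply duplicate_assoc. Qed.

Lemma dia_eta_at (X : C) : eta X = extract_at (dia X) \o unit_at X.
Proof. reflexivity. Qed.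

Lemma dia_mu_at (X : C) :
  mu X = counit_at (dia X) \o
    dia ◃ (counit_at (box (dia X)) \o
           dia ◃ (duplicate_at (dia X) \o unit_at X)).
Proof. reflexivity. Qed.

(** One direction of the hom-set bijection of the adjunction. Equations between maps out of [dia X]
    are proved by transposing them, which turns them into equations about the comonad. *)
Definition transpose (X Y : C) (f : hom (dia X) Y) : hom X (box Y) :=
  box ◃ f \o unit_at X.

Lemma counit_transpose (X Y : C) (f : hom (dia X) Y) :
  counit_at Y \o dia ◃ transpose f = f.
Proof.
unfold transpose. rewrite fmap_comp, comp_assoc.
rewrite counit_nat, <- comp_assoc, triangle_l. apply comp_idr.
Qed.

Lemma transpose_counit (X Y : C) (g : hom X (box Y)) :
  transpose (counit_at Y \o dia ◃ g) = g.
Proof.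
unfold transpose. rewrite fmap_comp, <- comp_assoc.
rewrite unit_nat, comp_assoc, triangle_r. apply comp_idl.
Qed.

Lemma transpose_inj (X Y : C) (f g : hom (dia X) Y) :
  transpose f = transpose g -> f = g.
Proof.
intros H. now rewrite <- (counit_transpose f), <- (counit_transpose g), H.
Qed.

Lemma transpose_comp (X Y Z : C) (g : hom Y Z) (f : hom (dia X) Y) :
  transpose (g \o f) = box ◃ g \o transpose f.
Proof. unfold transpose. now rewrite fmap_comp, comp_assoc. Qed.

Lemma transpose_fmap (X Y Z : C) (g : hom (dia Y) Z) (f : hom X Y) :
  transpose (g \o dia ◃ f) = transpose g \o f.
Proof.
unfold transpose. rewrite fmap_comp, <- !comp_assoc. f_equal.
apply unit_nat.
Qed.

Lemma transpose_mu (X : C) :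
  transpose (transpose (mu X)) = duplicate_at (dia X) \o unit_at X.
Proof. rewrite dia_mu_at. now rewrite !transpose_counit. Qed.

(** With [duplicate_transpose], the dictionary between comonad and monad: the counit after a
    transpose corresponds to [eta] before the map, the comultiplication to [mu]. Each monad law is
    read off from a comonad law in this way. *)
Lemma extract_transpose (X Y : C) (f : hom (dia X) Y) :
  extract_at Y \o transpose f = f \o eta X.
Proof.
rewrite ?dia_eta_at. unfold transpose. rewrite !comp_assoc. f_equal.
apply extract_nat.
Qed.

Lemma duplicate_transpose (X Y : C) (f : hom (dia X) Y) :
  duplicate_at Y \o transpose f = transpose (transpose (f \o mu X)).
Proof.
rewrite !transpose_comp, transpose_mu. unfold transpose. rewrite !comp_assoc.
f_equal. apply duplicate_nat.
Qed.

Lemma eta_nat (X Y : C) (f : hom X Y) : dia ◃ f \o eta X = eta Y \o f.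
Proof.
rewrite <- extract_transpose. rewrite dia_eta_at. unfold transpose.
rewrite <- comp_assoc. f_equal. apply unit_nat.
Qed.

Lemma mu_nat (X Y : C) (f : hom X Y) : dia ◃ f \o mu X = mu Y \o dia ◃ dia ◃ f.
Proof.
apply transpose_inj, transpose_inj.
rewrite <- duplicate_transpose, !transpose_fmap, transpose_mu.
unfold transpose. rewrite <- comp_assoc. f_equal.
apply unit_nat.
Qed.

Lemma mu_eta (X : C) : mu X \o eta (dia X) = idm (dia X).
Proof.
rewrite <- extract_transpose. apply transpose_inj.
rewrite transpose_comp, transpose_mu, comp_assoc, fmap_extract_at_duplicate.
unfold transpose. now rewrite fmap_id.
Qed.

Lemma mu_fmap_eta (X : C) : mu X \o dia ◃ eta X = idm (dia X).
Proof.
apply transpose_inj.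
rewrite transpose_fmap, <- extract_transpose, transpose_mu, comp_assoc,
  extract_at_duplicate.
unfold transpose. now rewrite fmap_id.
Qed.

Lemma mu_mu (X : C) : mu X \o mu (dia X) = mu X \o dia ◃ mu X.
Proof.
apply transpose_inj, transpose_inj. rewrite <- duplicate_transpose.
rewrite transpose_fmap. apply transpose_inj.
rewrite transpose_comp, transpose_mu, <- duplicate_transpose, transpose_mu.
now rewrite !comp_assoc, duplicate_at_assoc.
Qed.

Hypothesis hw : idempotent w.

(** Both sides are left inverses of [duplicate_at A], which idempotence makes an isomorphism. *)
Lemma extract_box (A : C) : extract_at (box A) = box ◃ extract_at A.
Proof.
assert (H : exists g : hom (box (box A)) (box A), duplicate_at A \o g = idm _).
{ destruct (hw A) as [g [_ Hg]]. now exists g. }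
destruct H as [g Hg].
rewrite <- (comp_idr (extract_at (box A))), <- (comp_idr (box ◃ extract_at A)), <- Hg.
now rewrite !comp_assoc, extract_at_duplicate, fmap_extract_at_duplicate.
Qed.

(** The counterpart of [extract_box] for the monad, obtained by transposing. *)
Lemma fmap_eta (X : C) : dia ◃ eta X = eta (dia X).
Proof.
apply transpose_inj.
rewrite <- (comp_idl (dia ◃ eta X)), transpose_fmap.
unfold transpose at 1. rewrite fmap_id, comp_idl.
rewrite ?dia_eta_at. unfold transpose. rewrite fmap_comp, <- extract_box, !comp_assoc.
f_equal. symmetry. apply extract_nat.
Qed.

Lemma eta_mu (X : C) : eta (dia X) \o mu X = idm (dia (dia X)).
Proof. now rewrite <- eta_nat, <- fmap_eta, <- fmap_comp, mu_eta, fmap_id. Qed.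

(* The terminal object is an algebra, so idempotence makes it a fixed point of
   the monad. *)
Lemma dia_one_uniq (K : cartesian_closed C) (X : C) (f g : hom X (dia (one K))) :
  f = g.
Proof.
assert (E : eta (one K) \o bang K (dia (one K)) = idm _).
{ rewrite <- eta_nat, <- fmap_eta, <- fmap_comp.
  rewrite (bang_uniq (bang K _ \o eta _)), <- (bang_uniq (idm (one K))).
  apply fmap_id. }
rewrite <- (comp_idl f), <- (comp_idl g), <- E, <- !comp_assoc.
f_equal. exact (eq_trans (bang_uniq _) (eq_sym (bang_uniq _))).
Qed.

End Monad.

(** * Terms *)

Definition upren (r : nat -> nat) (i : nat) : nat :=
  match i with 0 => 0 | S i => S (r i) end.

Fixpoint ren (r : nat -> nat) (t : tm) : tm :=
  match t with
  | tm_var i => tm_var (r i)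
  | tm_unit => tm_unit
  | tm_pair t u => tm_pair (ren r t) (ren r u)
  | tm_fst t => tm_fst (ren r t)
  | tm_snd t => tm_snd (ren r t)
  | tm_lam t => tm_lam (ren (upren r) t)
  | tm_app t u => tm_app (ren r t) (ren r u)
  | tm_shut t => tm_shut (ren r t)
  | tm_open t => tm_open (ren r t)
  end.

Definition up (s : nat -> tm) (i : nat) : tm :=
  match i with 0 => tm_var 0 | S i => ren S (s i) end.

Fixpoint subst (s : nat -> tm) (t : tm) : tm :=
  match t with
  | tm_var i => s i
  | tm_unit => tm_unit
  | tm_pair t u => tm_pair (subst s t) (subst s u)
  | tm_fst t => tm_fst (subst s t)
  | tm_snd t => tm_snd (subst s t)
  | tm_lam t => tm_lam (subst (up s) t)
  | tm_app t u => tm_app (subst s t) (subst s u)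
  | tm_shut t => tm_shut (subst s t)
  | tm_open t => tm_open (subst s t)
  end.

Definition scons (u : tm) (s : nat -> tm) (i : nat) : tm :=
  match i with 0 => u | S i => s i end.

Ltac fext := apply functional_extensionality; intros [|?]; simpl.

Lemma upren_comp (r q : nat -> nat) :
  (fun i => upren r (upren q i)) = upren (fun i => r (q i)).
Proof. now fext. Qed.

Lemma up_var (r : nat -> nat) : up (fun i => tm_var (r i)) = fun i => tm_var (upren r i).
Proof. now fext. Qed.

Lemma subst_var (r : nat -> nat) (t : tm) : subst (fun i => tm_var (r i)) t = ren r t.
Proof. revert r; induction t; intros r; simpl; rewrite ?up_var; f_equal; auto. Qed.

Lemma subst_id (t : tm) : subst tm_var t = t.
Proof.
induction t; simpl; try congruence.
change (up tm_var) with (up (fun i => tm_var i)). rewrite up_var.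
replace (fun i => tm_var (upren (fun i => i) i)) with tm_var by now fext.
congruence.
Qed.

Lemma ren_ren (r q : nat -> nat) (t : tm) : ren r (ren q t) = ren (fun i => r (q i)) t.
Proof.
revert r q; induction t; intros r q; simpl; try solve [f_equal; auto].
now rewrite IHt, upren_comp.
Qed.

Lemma subst_ren (s : nat -> tm) (r : nat -> nat) (t : tm) :
  subst s (ren r t) = subst (fun i => s (r i)) t.
Proof.
revert s r; induction t; intros s r; simpl; try solve [f_equal; auto].
rewrite IHt. do 2 f_equal. now fext.
Qed.

Lemma ren_subst (r : nat -> nat) (s : nat -> tm) (t : tm) :
  ren r (subst s t) = subst (fun i => ren r (s i)) t.
Proof.
revert r s; induction t; intros r s; simpl; try solve [f_equal; auto].
rewrite IHt. do 2 f_equal. fext; [easy|]. now rewrite !ren_ren.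
Qed.

Lemma subst_subst (s p : nat -> tm) (t : tm) :
  subst s (subst p t) = subst (fun i => subst s (p i)) t.
Proof.
revert s p; induction t; intros s p; simpl; try solve [f_equal; auto].
rewrite IHt. do 2 f_equal. fext; [easy|]. now rewrite subst_ren, ren_subst.
Qed.

Lemma subst_scons_up (u : tm) (p s : nat -> tm) (t : tm) :
  subst (scons u p) (subst (up s) t) = subst (scons u (fun i => subst p (s i))) t.
Proof. rewrite subst_subst. f_equal. fext; [easy|]. now rewrite subst_ren. Qed.

Lemma shift_ren (k c : nat) (t : tm) :
  shift k c t = ren (fun i => if Nat.ltb i c then i else i + k) t.
Proof.
revert c; induction t; intros c; simpl; try solve [f_equal; auto].
rewrite IHt. do 2 f_equal. fext; [easy|].
change (Nat.ltb (S n) (S c)) with (Nat.ltb n c). now destruct (Nat.ltb n c).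
Qed.

Lemma lift_ren (k : nat) (t : tm) : lift k t = ren (fun i => i + k) t.
Proof. apply shift_ren. Qed.

(** * Beta-reduction and normal forms *)

Inductive red : tm -> tm -> Prop :=
| red_refl t : red t t
| red_trans t u v : red t u -> red u v -> red t v
| red_beta t u : red (tm_app (tm_lam t) u) (subst (scons u tm_var) t)
| red_beta_fst t u : red (tm_fst (tm_pair t u)) t
| red_beta_snd t u : red (tm_snd (tm_pair t u)) u
| red_beta_open t : red (tm_open (tm_shut t)) t
| red_pair t t' u u' : red t t' -> red u u' -> red (tm_pair t u) (tm_pair t' u')
| red_fst t t' : red t t' -> red (tm_fst t) (tm_fst t')
| red_snd t t' : red t t' -> red (tm_snd t) (tm_snd t')
| red_lam t t' : red t t' -> red (tm_lam t) (tm_lam t')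
| red_app t t' u u' : red t t' -> red u u' -> red (tm_app t u) (tm_app t' u')
| red_shut t t' : red t t' -> red (tm_shut t) (tm_shut t')
| red_open t t' : red t t' -> red (tm_open t) (tm_open t').

Lemma red_ren (r : nat -> nat) (t t' : tm) : red t t' -> red (ren r t) (ren r t').
Proof.
intros H; revert r; induction H; intros r; simpl; try (econstructor; eauto; fail).
rewrite ren_subst.
replace (subst _ t) with (subst (scons (ren r u) tm_var) (ren (upren r) t)).
- apply red_beta.
- rewrite subst_ren. f_equal. now fext.
Qed.

Inductive neutral : tm -> Prop :=
| ne_var i : neutral (tm_var i)
| ne_fst t : neutral t -> neutral (tm_fst t)
| ne_snd t : neutral t -> neutral (tm_snd t)
| ne_app t u : neutral t -> normal u -> neutral (tm_app t u)
| ne_open t : neutral t -> neutral (tm_open t)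
with normal : tm -> Prop :=
| nf_neutral t : neutral t -> normal t
| nf_unit : normal tm_unit
| nf_pair t u : normal t -> normal u -> normal (tm_pair t u)
| nf_lam t : normal t -> normal (tm_lam t)
| nf_shut t : normal t -> normal (tm_shut t).

Scheme neutral_mut := Induction for neutral Sort Prop
with normal_mut := Induction for normal Sort Prop.
Combined Scheme neutral_normal_ind from neutral_mut, normal_mut.

Lemma neutral_normal_ren :
  (forall t, neutral t -> forall r, neutral (ren r t)) /\
  (forall t, normal t -> forall r, normal (ren r t)).
Proof.
apply (neutral_normal_ind (P := fun t _ => forall r, neutral (ren r t))
  (P0 := fun t _ => forall r, normal (ren r t))); simpl; intros; constructor; solve [auto].
Qed.

(** * Reducibility *)

Section Reducibility.
Variable P : Type.

Definition has_neutral (t : tm) : Prop := exists n, neutral n /\ red t n.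

(* The quantification over renamings [r] is a Kripke condition: the argument
   [u] may mention variables that the function does not. *)
Fixpoint reducible (A : ty P) (t : tm) : Prop :=
  has_neutral t \/
  match A with
  | ty_atom _ => False
  | ty_one => red t tm_unit
  | ty_prod A B =>
      exists t1 t2, red t (tm_pair t1 t2) /\ reducible A t1 /\ reducible B t2
  | ty_arr A B =>
      exists b, red t (tm_lam b) /\
        forall r u, reducible A u ->
          reducible B (subst (scons u (fun i => tm_var (r i))) b)
  | ty_box A => exists s, red t (tm_shut s) /\ reducible A s
  end.

Lemma reducible_neutral (A : ty P) (t : tm) : has_neutral t -> reducible A t.
Proof. destruct A; now left. Qed.

Lemma reducible_var (A : ty P) (i : nat) : reducible A (tm_var i).
Proof.
apply reducible_neutral. exists (tm_var i). split; [apply ne_var | apply red_refl].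
Qed.

(** Every clause of [reducible] speaks of what [t] reduces to, so a reduction can be prefixed by
    transitivity. *)
Lemma reducible_expand (A : ty P) (t t' : tm) :
  red t t' -> reducible A t' -> reducible A t.
Proof.
intros H R.
assert (N : has_neutral t' -> has_neutral t).
{ intros [n [Hn Hr]]. exists n. eauto using red_trans. }
destruct A; simpl in *; destruct R as [R|R]; auto; right.
- eauto using red_trans.
- destruct R as (a & b & R & ?). exists a, b. eauto using red_trans.
- destruct R as (b & R & ?). exists b. eauto using red_trans.
- destruct R as (b & R & ?). exists b. eauto using red_trans.
Qed.

Lemma reducible_ren (A : ty P) (t : tm) (r : nat -> nat) :
  reducible A t -> reducible A (ren r t).
Proof.
assert (N : forall t, has_neutral t -> has_neutral (ren r t)).
{ intros u [n [Hn Hr]]. exists (ren r n).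
  split; [now apply neutral_normal_ren | now apply red_ren]. }
revert t; induction A; intros t; simpl; (intros [R|R]; [left; auto | right]).
- destruct R.
- now apply (red_ren r) in R.
- destruct R as (a & b & R & Ra & Rb). exists (ren r a), (ren r b).
  repeat split; auto. now apply (red_ren r) in R.
- destruct R as (b & R & Rb). exists (ren (upren r) b).
  split; [now apply (red_ren r) in R|].
  intros q u Hu. rewrite subst_ren.
  replace (fun i => scons u _ (upren r i))
    with (scons u (fun i => tm_var (q (r i)))) by now fext.
  auto.
- destruct R as (s & R & Rs). exists (ren r s).
  split; [now apply (red_ren r) in R | auto].
Qed.

Lemma reducible_normalizes (A : ty P) (t : tm) :
  reducible A t -> exists n, normal n /\ red t n.
Proof.
assert (N : forall t, has_neutral t -> exists n, normal n /\ red t n).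
{ intros u [n [Hn Hr]]. exists n. split; [now apply nf_neutral | easy]. }
revert t; induction A; intros t; simpl; (intros [R|R]; [auto|]).
- destruct R.
- exists tm_unit. split; [apply nf_unit | easy].
- destruct R as (a & b & R & Ra & Rb).
  destruct (IHA1 _ Ra) as (a' & ? & ?), (IHA2 _ Rb) as (b' & ? & ?).
  exists (tm_pair a' b'). split; [now apply nf_pair|].
  eapply red_trans; [exact R | now apply red_pair].
- destruct R as (b & R & Rb).
  (* A fresh variable as argument: weakening by [S] and then putting [tm_var 0] in front is the
     identity substitution, so the body itself is reducible. *)
  specialize (Rb S (tm_var 0) (reducible_var A1 0)).
  replace (scons _ _) with tm_var in Rb by now fext.
  rewrite subst_id in Rb. destruct (IHA2 _ Rb) as (b' & ? & ?).
  exists (tm_lam b'). split; [now apply nf_lam|].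
  eapply red_trans; [exact R | now apply red_lam].
- destruct R as (s & R & Rs). destruct (IHA _ Rs) as (s' & ? & ?).
  exists (tm_shut s'). split; [now apply nf_shut|].
  eapply red_trans; [exact R | now apply red_shut].
Qed.

End Reducibility.

(** * Contexts with ghost variables *)

(* A ghost is a variable that has been discarded by [open] but still occupies a
   de Bruijn index, so that discarding variables does not renumber the others. *)
Inductive gctx (P : Type) :=
| g_nil
| g_var (G : gctx P) (A : ty P)
| g_lock (G : gctx P)
| g_ghost (G : gctx P).
Arguments g_nil {P}.

Section Interpretation.
Variables (C : category) (K : cartesian_closed C) (dia box : functor C C).
Variables (adj : adjunction dia box) (w : comonad box).
Variables (P : Type) (rho : P -> C).

Local Notation eta := (dia_eta adj w).
Local Notation mu := (dia_mu adj w).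
Local Notation "F ◃ f" := (fmap F f) (at level 30, right associativity).
Local Notation dty := (den_ty K box rho).

Fixpoint ob (G : gctx P) : C :=
  match G with
  | g_nil => one K
  | g_var G A => prod K (ob G) (dty A)
  | g_lock G => dia (ob G)
  | g_ghost G => ob G
  end.

(** The context to which [open] goes back when it discards the last [n] entries. Locks disappear,
    and variables leave ghosts, which count as entries when discarding again. *)
Fixpoint kill (n : nat) (G : gctx P) : gctx P :=
  match n with
  | 0 => G
  | S n =>
      match G with
      | g_nil => g_nil
      | g_var G _ => g_ghost (kill n G)
      | g_lock G => kill n G
      | g_ghost G => g_ghost (kill n G)
      end
  end.

(** Lock replacement for the discarded end, as in [lock_replace], but keeping the rest of the
    context as target. *)
Fixpoint lk (n : nat) (G : gctx P) : hom (ob G) (dia (ob (kill n G))) :=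
  match n return hom (ob G) (dia (ob (kill n G))) with
  | 0 => eta (ob G)
  | S n =>
      match G return hom (ob G) (dia (ob (kill (S n) G))) with
      | g_nil => eta (one K)
      | g_var G _ => lk n G \o pr1 K
      | g_lock G => mu (ob (kill n G)) \o dia ◃ lk n G
      | g_ghost G => lk n G
      end
  end.

(** Allows maps into denotations of different types to be compared, since a term need not fix its
    type in advance. *)
Definition pack (X : C) (A : ty P) (f : hom X (dty A)) : {A : ty P & hom X (dty A)} :=
  existT _ A f.

Lemma pack_ty (X : C) (A B : ty P) (f : hom X (dty A)) (g : hom X (dty B)) :
  pack f = pack g -> A = B.
Proof. apply (f_equal (@projT1 _ _)). Qed.

(** Relies on uniqueness of identity proofs, as an axiom: equality on the atoms [P] need not be
    decidable. *)
Lemma pack_inj (X : C) (A : ty P) (f g : hom X (dty A)) : pack f = pack g -> f = g.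
Proof. apply inj_pair2. Qed.

Fixpoint look (G : gctx P) (i : nat) (A : ty P) : hom (ob G) (dty A) -> Prop :=
  match G return hom (ob G) (dty A) -> Prop with
  | g_nil => fun _ => False
  | g_var G B => fun f =>
      match i with
      | 0 => pack f = pack (A := B) (pr2 K)
      | S i => exists g, @look G i A g /\ f = g \o pr1 K
      end
  | g_lock _ => fun _ => False
  | g_ghost G => fun f => match i with 0 => False | S i => @look G i A f end
  end.
Arguments look G i {A} f.

(* [interp t G f]: the term [t] has in [G] a derivation that denotes [f]. *)
Fixpoint interp (t : tm) (G : gctx P) (A : ty P) {struct t} :
  hom (ob G) (dty A) -> Prop :=
  match t with
  | tm_var i => fun f => look G i f
  | tm_unit =>
      match A return hom (ob G) (dty A) -> Prop with
      | ty_one => fun _ => True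
      | _ => fun _ => False
      end
  | tm_pair t u =>
      match A return hom (ob G) (dty A) -> Prop with
      | ty_prod A B => fun f => exists g h,
          @interp t G A g /\ @interp u G B h /\ f = pairing K g h
      | _ => fun _ => False
      end
  | tm_fst t => fun f => exists B g,
      @interp t G (ty_prod A B) g /\ f = pr1 K \o g
  | tm_snd t => fun f => exists B g,
      @interp t G (ty_prod B A) g /\ f = pr2 K \o g
  | tm_lam t =>
      match A return hom (ob G) (dty A) -> Prop with
      | ty_arr A B => fun f => exists g, @interp t (g_var G A) B g /\ f = curry g
      | _ => fun _ => False
      end
  | tm_app t u => fun f => exists B g h,
      @interp t G (ty_arr B A) g /\ @interp u G B h /\
      f = ev K \o pairing K g h
  | tm_shut t =>
      match A return hom (ob G) (dty A) -> Prop with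
      | ty_box A => fun f => exists g,
          @interp t (g_lock G) A g /\ f = transpose adj g
      | _ => fun _ => False
      end
  | tm_open t => fun f => exists n g,
      @interp t (kill n G) (ty_box A) g /\
      f = counit_at adj (dty A) \o dia ◃ g \o lk n G
  end.
Arguments interp t G {A} f.

Lemma look_uniq (G : gctx P) (i : nat) (A : ty P) (f : hom (ob G) (dty A)) :
  look G i f -> forall (B : ty P) (g : hom (ob G) (dty B)),
  look G i g -> pack f = pack g.
Proof.
revert i A f; induction G as [|G IH D|G IH|G IH]; intros i A f H B g H'; simpl in *;
  try easy.
- destruct i as [|i].
  + exact (eq_trans H (eq_sym H')).
  + destruct H as (f' & H & ->), H' as (g' & H' & ->).
    pose proof (IH _ _ _ H _ _ H') as E. destruct (pack_ty E).
    now rewrite (pack_inj E).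
- destruct i as [|i]; [easy | now apply (IH i)].
Qed.

(** * Composition of discards *)

Definition kill_at (n : nat) (G : gctx P) :
  {D : gctx P & hom (ob G) (dia (ob D))} := existT _ (kill n G) (lk n G).

(** The Kleisli composite of two discards. The context is packed with the map because the composite
    context is only propositionally of the form [kill m G]. *)
Definition kill_twice (d n : nat) (G : gctx P) :
  {D : gctx P & hom (ob G) (dia (ob D))} :=
  existT _ (kill d (kill n G)) (mu _ \o dia ◃ lk d (kill n G) \o lk n G).

Lemma kill_twice_0 (d : nat) (G : gctx P) : kill_twice d 0 G = kill_at d G.
Proof.
unfold kill_twice, kill_at. simpl. f_equal.
now rewrite <- comp_assoc, eta_nat, comp_assoc, mu_eta, comp_idl.
Qed.

Lemma kill_twice_0l (n : nat) (G : gctx P) : kill_twice 0 n G = kill_at n G.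
Proof. unfold kill_twice, kill_at. simpl. f_equal. now rewrite mu_fmap_eta, comp_idl. Qed.

Lemma kill_twice_nil (d n : nat) :
  kill_twice d n g_nil = kill_at 0 g_nil.
Proof.
assert (E : kill_twice d n g_nil = kill_twice d 0 g_nil) by now destruct n.
rewrite E, kill_twice_0. now destruct d.
Qed.

Definition at_var (G : gctx P) (A : ty P) (p : {D : gctx P & hom (ob G) (dia (ob D))}) :
  {D : gctx P & hom (ob (g_var G A)) (dia (ob D))} :=
  existT (fun D => hom (ob (g_var G A)) (dia (ob D))) (g_ghost (projT1 p))
    (projT2 p \o pr1 K).

Definition at_ghost (G : gctx P) (p : {D : gctx P & hom (ob G) (dia (ob D))}) :
  {D : gctx P & hom (ob (g_ghost G)) (dia (ob D))} :=
  existT (fun D => hom (ob (g_ghost G)) (dia (ob D))) (g_ghost (projT1 p)) (projT2 p).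

Definition at_lock (G : gctx P) (p : {D : gctx P & hom (ob G) (dia (ob D))}) :
  {D : gctx P & hom (ob (g_lock G)) (dia (ob D))} :=
  existT (fun D => hom (ob (g_lock G)) (dia (ob D))) (projT1 p)
    (mu _ \o dia ◃ projT2 p).

Lemma kill_twice_var (d n : nat) (G : gctx P) (A : ty P) :
  kill_twice (S d) (S n) (g_var G A) = at_var A (kill_twice d n G).
Proof. unfold kill_twice, at_var; simpl. now rewrite !comp_assoc. Qed.

Lemma kill_twice_ghost (d n : nat) (G : gctx P) :
  kill_twice (S d) (S n) (g_ghost G) = at_ghost (kill_twice d n G).
Proof. reflexivity. Qed.

Lemma kill_twice_lock (d n : nat) (G : gctx P) :
  kill_twice d (S n) (g_lock G) = at_lock (kill_twice d n G).
Proof.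
unfold kill_twice, at_lock; simpl. f_equal.
rewrite !fmap_comp, !comp_assoc, <- mu_mu, <- (comp_assoc (mu _) (mu _)), <- mu_nat.
now rewrite !comp_assoc.
Qed.

(** The number [m] depends on [G]: the second discard counts again the ghosts left by the first, but
    not the locks that it removed. *)
Lemma kill_compose (G : gctx P) (n d : nat) :
  exists m, kill_twice d n G = kill_at m G.
Proof.
revert n d; induction G as [|G IH A|G IH|G IH]; intros n d.
{ exists 0. apply kill_twice_nil. }
all: destruct n as [|n]; [exists d; apply kill_twice_0|].
- destruct d as [|d]; [exists (S n); apply kill_twice_0l|].
  destruct (IH n d) as [m E]. exists (S m). now rewrite kill_twice_var, E.
- destruct (IH n d) as [m E]. exists (S m). now rewrite kill_twice_lock, E.
- destruct d as [|d]; [exists (S n); apply kill_twice_0l|].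
  destruct (IH n d) as [m E]. exists (S m). now rewrite kill_twice_ghost, E.
Qed.

(** The discards of one context are linearly ordered: a longer one passes through every shorter
    one. *)
Lemma kill_split (G : gctx P) (n m : nat) :
  n <= m -> exists d, kill_at m G = kill_twice d n G.
Proof.
revert n m; induction G as [|G IH A|G IH|G IH]; intros n m L.
{ exists 0. rewrite kill_twice_nil. now destruct m. }
all: destruct n as [|n]; [exists m; now rewrite kill_twice_0|].
all: destruct m as [|m]; [lia|]; destruct (IH n m) as [d E]; [lia|].
- exists (S d). now rewrite kill_twice_var, <- E.
- exists d. now rewrite kill_twice_lock, <- E.
- exists (S d). now rewrite kill_twice_ghost, <- E.
Qed.

(** * Substitution *)

(** Renaming and substitution are treated at once, for a general [entry]. The instance [var_entry]
    comes first and yields the weakenings of [interp] that the instance [term_entry] requires. *)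
Definition entry : Type := forall (G : gctx P) (u : tm) (A : ty P), hom (ob G) (dty A) -> Prop.

Definition var_entry : entry := fun G u A a => exists i, u = tm_var i /\ look G i a.

Definition term_entry : entry := fun G u A a => interp u G a.

(* [sub V G D s m]: the substitution [s] replaces the variables of [D] by terms
   in [G] that satisfy [V], and denotes [m].  A lock of [D] may be mapped to any
   way of discarding the end of [G]. *)
Fixpoint sub (V : entry) (G D : gctx P) (s : nat -> tm) {struct D} :
  hom (ob G) (ob D) -> Prop :=
  match D return hom (ob G) (ob D) -> Prop with
  | g_nil => fun _ => True
  | g_var D A => fun m => exists m' a,
      sub V (fun i => s (S i)) m' /\ V G (s 0) A a /\ m = pairing K m' a
  | g_lock D => fun m => exists n m',
      @sub V (kill n G) D s m' /\ m = dia ◃ m' \o lk n G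
  | g_ghost D => fun m => @sub V G D (fun i => s (S i)) m
  end.
Arguments sub V G D s m : clear implicits.

Lemma sub_mono (V V' : entry) :
  (forall G u A (a : hom (ob G) (dty A)), V G u A a -> V' G u A a) ->
  forall D G s m, sub V G D s m -> sub V' G D s m.
Proof.
intros HV D; induction D as [|D IH A|D IH|D IH]; intros G s m; simpl; auto.
- intros (m' & a & H & Ha & ->). exists m', a. auto.
- intros (n & m' & H & ->). exists n, m'. auto.
Qed.

Section Weakening.
Variable V : entry.
Hypothesis V_ghost : forall G u A (a : hom (ob G) (dty A)),
  @V G u A a -> @V (g_ghost G) (ren S u) A a.
Hypothesis V_var : forall G B u A (a : hom (ob G) (dty A)),
  @V G u A a -> @V (g_var G B) (ren S u) A (a \o pr1 K).

Lemma sub_ghost (D G : gctx P) (s : nat -> tm) (m : hom (ob G) (ob D)) :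
  sub V G D s m -> sub V (g_ghost G) D (fun i => ren S (s i)) m.
Proof.
revert G s m; induction D as [|D IH A|D IH|D IH]; intros G s m; simpl; auto.
- intros (m' & a & H & Ha & ->). exists m', a.
  repeat split; [now apply (IH G (fun i => s (S i))) | auto].
(* The new ghost is one more entry to go past. *)
- intros (n & m' & H & ->). exists (S n), m'. split; [now apply IH | reflexivity].
Qed.

Lemma sub_weaken (B : ty P) (D G : gctx P) (s : nat -> tm) (m : hom (ob G) (ob D)) :
  sub V G D s m -> sub V (g_var G B) D (fun i => ren S (s i)) (m \o pr1 K).
Proof.
revert G s m; induction D as [|D IH A|D IH|D IH]; intros G s m; simpl; auto.
- intros (m' & a & H & Ha & ->). exists (m' \o pr1 K), (a \o pr1 K).
  repeat split; [now apply (IH G (fun i => s (S i))) | auto | apply pairing_comp].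
- intros (n & m' & H & ->). exists (S n), m'. split.
  + now apply sub_ghost.
  + simpl. now rewrite comp_assoc.
Qed.

Lemma sub_lock (D G : gctx P) (s : nat -> tm) (m : hom (ob G) (ob D)) :
  sub V G D s m -> sub V (g_lock G) (g_lock D) s (dia ◃ m).
Proof.
(* Discarding one entry removes exactly the new lock, and [lk 1] is then [mu] after [dia ◃ eta], the
   identity. *)
intros H. exists 1, m. split; [exact H|]. simpl. now rewrite mu_fmap_eta, comp_idr.
Qed.

Hypothesis V_top : forall G A, @V (g_var G A) (tm_var 0) A (pr2 K).

Lemma sub_up (A : ty P) (D G : gctx P) (s : nat -> tm) (m : hom (ob G) (ob D)) :
  sub V G D s m ->
  sub V (g_var G A) (g_var D A) (up s) (pairing K (m \o pr1 K) (pr2 K)).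
Proof.
intros H. exists (m \o pr1 K), (pr2 K).
repeat split; [now apply (@sub_weaken A D G s m) | apply V_top].
Qed.

Lemma sub_id (G : gctx P) : sub V G G tm_var (idm (ob G)).
Proof.
induction G as [|G IH A|G IH|G IH].
- exact I.
- exists (pr1 K), (pr2 K). repeat split.
  + apply (sub_weaken A) in IH. now rewrite comp_idl in IH.
  + apply V_top.
  + symmetry. apply pairing_eta.
- apply sub_lock in IH. now rewrite fmap_id in IH.
- apply sub_ghost in IH. exact IH.
Qed.

(** For the [open] case of substitution: a discard in [D] is carried across to a discard in [G].
    Each lock removed from [D] contributes the discard to which the substitution sends it, and
    [kill_compose] merges these into one. *)
Lemma sub_kill (D G : gctx P) (s : nat -> tm) (m : hom (ob G) (ob D)) (n : nat) :
  sub V G D s m ->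
  exists k m', sub V (kill k G) (kill n D) s m' /\ dia ◃ m' \o lk k G = lk n D \o m.
Proof.
revert n G s m; induction D as [|D IH A|D IH|D IH]; intros [|n] G s m H.
all: try (exists 0, m; split; [exact H | apply eta_nat]).
- destruct H as (m' & a & H & Ha & ->).
  destruct (IH n G (fun i => s (S i)) m' H) as (k & p & Hp & E).
  exists k, p. split; [exact Hp|]. simpl. now rewrite <- comp_assoc, pr1_pairing.
- destruct H as (l & m' & H & ->).
  destruct (IH n (kill l G) s m' H) as (k & p & Hp & E).
  destruct (kill_compose G l k) as [j Ej].
  (* Abstracting over the packed pair lets [Ej] be rewritten although the maps depend on the
     context. *)
  set (Q := fun q : {G' : gctx P & hom (ob G) (dia (ob G'))} =>
    exists p, sub V (projT1 q) (kill n D) s p /\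
      dia ◃ p \o projT2 q = lk (S n) (g_lock D) \o (dia ◃ m' \o lk l G)).
  assert (HQ : Q (kill_twice k l G)).
  { exists p. split; [exact Hp|]. simpl.
    rewrite !comp_assoc, mu_nat, <- !comp_assoc. f_equal.
    now rewrite !comp_assoc, <- !fmap_comp, E. }
  rewrite Ej in HQ. destruct HQ as [q Hq]. now exists j, q.
- destruct (IH n G (fun i => s (S i)) m H) as (k & p & Hp & E). now exists k, p.
Qed.

Hypothesis V_interp : forall G u A (a : hom (ob G) (dty A)), @V G u A a -> interp u G a.

Lemma look_sub (D G : gctx P) (i : nat) (A : ty P) (f : hom (ob D) (dty A))
  (s : nat -> tm) (m : hom (ob G) (ob D)) :
  look D i f -> sub V G D s m -> @V G (s i) A (f \o m).
Proof.
revert i G f s m; induction D as [|D IH B|D IH|D IH]; intros i G f s m H Hs;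
  simpl in H; try easy.
- destruct Hs as (m' & a & Hs & Ha & ->). destruct i as [|i].
  + destruct (pack_ty H). apply pack_inj in H as ->. simpl. now rewrite pr2_pairing.
  + destruct H as (g & H & ->). simpl. rewrite <- comp_assoc, pr1_pairing.
    now apply (IH i G g (fun i => s (S i))).
- destruct i as [|i]; [easy|]. now apply (IH i G f (fun i => s (S i))).
Qed.

Lemma interp_subst (t : tm) (D G : gctx P) (A : ty P) (f : hom (ob D) (dty A))
  (s : nat -> tm) (m : hom (ob G) (ob D)) :
  interp t D f -> sub V G D s m -> interp (subst s t) G (f \o m).
Proof.
revert D G A f s m; induction t; intros D G A f s m H Hs; simpl in *.
- apply V_interp. exact (look_sub H Hs).
- destruct A; easy.
- destruct A; try easy. destruct H as (g & h & Hg & Hh & ->).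
  exists (g \o m), (h \o m). repeat split; eauto. apply pairing_comp.
- destruct H as (B & g & H & ->). exists B, (g \o m).
  split; eauto. now rewrite comp_assoc.
- destruct H as (B & g & H & ->). exists B, (g \o m).
  split; eauto. now rewrite comp_assoc.
- destruct A; try easy. destruct H as (g & H & ->).
  eexists. split; [exact (IHt _ _ _ _ _ _ H (sub_up A1 Hs)) | apply curry_comp].
- destruct H as (B & g & h & Hg & Hh & ->). exists B, (g \o m), (h \o m).
  repeat split; eauto. now rewrite <- comp_assoc, pairing_comp.
- destruct A; try easy. destruct H as (g & H & ->).
  eexists. split; [exact (IHt _ _ _ _ _ _ H (sub_lock Hs))|].
  symmetry. apply transpose_fmap.
- destruct H as (n & g & H & ->). destruct (sub_kill n Hs) as (k & m' & Hs' & E).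
  exists k, (g \o m'). split; [now apply (IHt (kill n D))|].
  now rewrite fmap_comp, <- !comp_assoc, E.
Qed.

End Weakening.

Lemma var_entry_ghost (G : gctx P) (u : tm) (A : ty P) (a : hom (ob G) (dty A)) :
  var_entry u a -> @var_entry (g_ghost G) (ren S u) A a.
Proof. intros (i & -> & H). now exists (S i). Qed.

Lemma var_entry_var (G : gctx P) (B : ty P) (u : tm) (A : ty P)
  (a : hom (ob G) (dty A)) :
  var_entry u a -> @var_entry (g_var G B) (ren S u) A (a \o pr1 K).
Proof. intros (i & -> & H). exists (S i). split; [easy|]. now exists a. Qed.

Lemma var_entry_top (G : gctx P) (A : ty P) : @var_entry (g_var G A) (tm_var 0) A (pr2 K).
Proof. now exists 0. Qed.

Lemma var_entry_interp (G : gctx P) (u : tm) (A : ty P) (a : hom (ob G) (dty A)) :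
  var_entry u a -> interp u G a.
Proof. now intros (i & -> & H). Qed.

Definition var_sub_ghost := sub_ghost var_entry_ghost.
Definition var_sub_weaken := sub_weaken var_entry_ghost var_entry_var.
Definition var_sub_id := sub_id var_entry_ghost var_entry_var var_entry_top.
Definition interp_var_subst :=
  interp_subst var_entry_ghost var_entry_var var_entry_top var_entry_interp.

Lemma subst_var_S (t : tm) : subst (fun i => ren S (tm_var i)) t = ren S t.
Proof. exact (subst_var S t). Qed.

Lemma interp_ghost (G : gctx P) (t : tm) (A : ty P) (f : hom (ob G) (dty A)) :
  interp t G f -> interp (A := A) (ren S t) (g_ghost G) f.
Proof.
intros H. rewrite <- subst_var_S, <- (comp_idr f).
exact (interp_var_subst H (var_sub_ghost (var_sub_id G))).
Qed.

Lemma interp_weaken (G : gctx P) (B : ty P) (t : tm) (A : ty P)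
  (f : hom (ob G) (dty A)) :
  interp t G f -> interp (ren S t) (g_var G B) (f \o pr1 K).
Proof.
intros H. rewrite <- subst_var_S, <- (comp_idl (pr1 K)).
exact (interp_var_subst H (var_sub_weaken B (var_sub_id G))).
Qed.

Lemma interp_top (G : gctx P) (A : ty P) : interp (A := A) (tm_var 0) (g_var G A) (pr2 K).
Proof. reflexivity. Qed.

Definition interp_term_subst :=
  @interp_subst term_entry interp_ghost interp_weaken interp_top (fun _ _ _ _ H => H).

(** * Subject reduction with preservation of denotations *)

Lemma red_interp (t t' : tm) :
  red t t' -> forall G A (f : hom (ob G) (dty A)), interp t G f -> interp t' G f.
Proof.
intros R; induction R; intros G A f H.
- exact H.
- auto.
- destruct H as (B & g & a & (h & Hh & ->) & Ha & ->).
  rewrite ev_curry_pairing. apply (interp_term_subst Hh).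
  exists (idm _), a. repeat split; [| exact Ha].
  exact (sub_mono (V' := term_entry) var_entry_interp (var_sub_id G)).
- destruct H as (B & g & (h & k & Hh & Hk & ->) & ->). now rewrite pr1_pairing.
- destruct H as (B & g & (h & k & Hh & Hk & ->) & ->). now rewrite pr2_pairing.
(* The body lives in [g_lock (kill n G)]. The identity substitution, sending that lock to the
   discard of [n] entries, denotes [lk n G]; thanks to the ghosts no index changes. *)
- destruct H as (n & g & (h & Hh & ->) & ->). rewrite counit_transpose, <- (subst_id t).
  apply (interp_var_subst Hh). exists n, (idm _).
  split; [apply var_sub_id | now rewrite fmap_id, comp_idl].
- destruct A; try easy. destruct H as (g & h & Hg & Hh & ->). exists g, h. auto.
- destruct H as (B & g & H & ->). exists B, g. auto.
- destruct H as (B & g & H & ->). exists B, g. auto.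
- destruct A; try easy. destruct H as (g & H & ->). exists g. auto.
- destruct H as (B & g & h & Hg & Hh & ->). exists B, g, h. auto.
- destruct A; try easy. destruct H as (g & H & ->). exists g. auto.
- destruct H as (n & g & H & ->). exists n, g. auto.
Qed.

(** * Normalization of typed terms *)

Fixpoint reducible_env (G : gctx P) (s : nat -> tm) : Prop :=
  match G with
  | g_nil => True
  | g_var G A => reducible A (s 0) /\ reducible_env G (fun i => s (S i))
  | g_lock G => reducible_env G s
  | g_ghost G => reducible_env G (fun i => s (S i))
  end.

Lemma reducible_env_kill (n : nat) (G : gctx P) (s : nat -> tm) :
  reducible_env G s -> reducible_env (kill n G) s.
Proof.
revert n s; induction G as [|G IH A|G IH|G IH]; intros [|n] s H; auto; simpl in *.
- now apply IH.
- now apply IH.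
- now apply IH.
Qed.

Lemma reducible_env_ren (r : nat -> nat) (G : gctx P) (s : nat -> tm) :
  reducible_env G s -> reducible_env G (fun i => ren r (s i)).
Proof.
revert s; induction G as [|G IH A|G IH|G IH]; intros s H; simpl in *; auto.
- split; [now apply reducible_ren | now apply (IH (fun i => s (S i)))].
Qed.

Lemma reducible_env_var (G : gctx P) (r : nat -> nat) :
  reducible_env G (fun i => tm_var (r i)).
Proof.
revert r; induction G as [|G IH A|G IH|G IH]; intros r; simpl; auto.
- split; [apply reducible_var | apply (IH (fun i => r (S i)))].
Qed.

Lemma look_reducible (G : gctx P) (i : nat) (A : ty P) (f : hom (ob G) (dty A))
  (s : nat -> tm) :
  look G i f -> reducible_env G s -> reducible A (s i).
Proof.
revert i f s; induction G as [|G IH B|G IH|G IH]; intros i f s H Hs; simpl in *;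
  try easy.
- destruct Hs as [H0 Hs]. destruct i as [|i].
  + now destruct (pack_ty H).
  + destruct H as (g & H & _). exact (IH i g (fun i => s (S i)) H Hs).
- destruct i as [|i]; [easy|]. exact (IH i f (fun i => s (S i)) H Hs).
Qed.

(** The fundamental lemma of reducibility. Locks put no condition on an environment, and discarding
    only weakens the condition, so the modal cases follow the pattern of the others. *)
Lemma interp_reducible (t : tm) (G : gctx P) (A : ty P) (f : hom (ob G) (dty A))
  (s : nat -> tm) :
  interp t G f -> reducible_env G s -> reducible A (subst s t).
Proof.
revert G A f s; induction t; intros G A f s H Hs; simpl in H |- *.
- exact (look_reducible H Hs).
- destruct A; try easy. right. apply red_refl.
- destruct A; try easy. destruct H as (g & h & Hg & Hh & _). right.
  eexists _, _. split; [apply red_refl | eauto].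
- destruct H as (B & g & H & _).
  destruct (IHt _ _ _ s H Hs) as [[n [Hn R]] | (a & b & R & Ra & Rb)].
  + apply reducible_neutral. exists (tm_fst n). split; [now apply ne_fst | now apply red_fst].
  + apply reducible_expand with a; [|easy].
    eapply red_trans; [apply red_fst, R | apply red_beta_fst].
- destruct H as (B & g & H & _).
  destruct (IHt _ _ _ s H Hs) as [[n [Hn R]] | (a & b & R & Ra & Rb)].
  + apply reducible_neutral. exists (tm_snd n). split; [now apply ne_snd | now apply red_snd].
  + apply reducible_expand with b; [|easy].
    eapply red_trans; [apply red_snd, R | apply red_beta_snd].
- destruct A; try easy. destruct H as (g & H & _). right.
  eexists. split; [apply red_refl|]. intros r u Hu. rewrite subst_scons_up.
  apply (IHt _ _ _ _ H). split; [exact Hu|]. simpl.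
  replace (fun i => subst _ (s i)) with (fun i => ren r (s i)).
  + now apply reducible_env_ren.
  + apply functional_extensionality. intros i. symmetry. apply subst_var.
- destruct H as (B & g & h & Hg & Hh & _).
  pose proof (IHt2 _ _ _ s Hh Hs) as Ru.
  destruct (IHt1 _ _ _ s Hg Hs) as [[n [Hn R]] | (b & R & Rb)].
  (* An application with neutral head is neutral only if its argument is normal. *)
  + destruct (reducible_normalizes Ru) as (u & Hu & Ru').
    apply reducible_neutral. exists (tm_app n u).
    split; [now apply ne_app | now apply red_app].
  + eapply reducible_expand; [|exact (Rb (fun i => i) _ Ru)].
    eapply red_trans; [apply red_app; [exact R | apply red_refl] | apply red_beta].
- destruct A; try easy. destruct H as (g & H & _). right.
  eexists. split; [apply red_refl | eauto].
- destruct H as (n & g & H & _).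
  destruct (IHt _ _ _ s H (reducible_env_kill n Hs)) as [[u [Hu R]] | (a & R & Ra)].
  + apply reducible_neutral. exists (tm_open u).
    split; [now apply ne_open | now apply red_open].
  + apply reducible_expand with a; [|easy].
    eapply red_trans; [apply red_open, R | apply red_beta_open].
Qed.

Lemma interp_normalizes (t : tm) (G : gctx P) (A : ty P) (f : hom (ob G) (dty A)) :
  interp t G f -> exists n, normal n /\ red t n.
Proof.
intros H. apply (reducible_normalizes (A := A)). rewrite <- (subst_id t).
exact (interp_reducible H (reducible_env_var G (fun i => i))).
Qed.

(** * Coherence of variable substitutions *)

(** A variable visible in both contexts has no lock to its right and lies to the left of the
    discarded variables. Hence no lock is discarded, and the lock replacement is a projection
    followed by [eta]. *)
Lemma var_sub_kill_look (G : gctx P) (d i : nat) (A B : ty P)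
  (a : hom (ob G) (dty A)) (b : hom (ob (kill d G)) (dty B)) :
  look G i a -> look (kill d G) i b ->
  exists p, sub var_entry G (kill d G) tm_var p /\ lk d G = eta _ \o p.
Proof.
revert d i A B a b; induction G as [|G IH D|G IH|G IH]; intros [|d] i A B a b Ha Hb;
  try easy.
- exists (idm _). split; [apply var_sub_id | symmetry; apply comp_idr].
- destruct i as [|i]; [easy|]. destruct Ha as (a' & Ha & _).
  destruct (IH d i _ _ a' b Ha Hb) as (p & Hp & E).
  exists (p \o pr1 K). split; [exact (var_sub_weaken D Hp)|].
  simpl. now rewrite comp_assoc, E.
- exists (idm _). split; [apply var_sub_id | symmetry; apply comp_idr].
- destruct i as [|i]; [easy|].
  destruct (IH d i _ _ a b Ha Hb) as (p & Hp & E).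
  exists p. split; [exact (var_sub_ghost Hp) | exact E].
Qed.

Lemma var_sub_comp (E D G : gctx P) (s r : nat -> tm) (m : hom (ob D) (ob E))
  (p : hom (ob G) (ob D)) :
  sub var_entry D E s m -> sub var_entry G D r p ->
  sub var_entry G E (fun i => subst r (s i)) (m \o p).
Proof.
revert D G s r m p; induction E as [|E IH A|E IH|E IH]; intros D G s r m p Hm Hp.
- exact I.
- destruct Hm as (m' & a & Hm & (i & Ei & Ha) & ->).
  exists (m' \o p), (a \o p). repeat split.
  + exact (IH D G (fun i => s (S i)) r m' p Hm Hp).
  + rewrite Ei. exact (look_sub Ha Hp).
  + apply pairing_comp.
- destruct Hm as (n & m' & Hm & ->).
  destruct (sub_kill n Hp) as (k & p' & Hp' & Ek).
  exists k, (m' \o p'). split; [now apply (IH (kill n D))|].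
  rewrite fmap_comp, <- !comp_assoc. now f_equal.
- exact (IH D G (fun i => s (S i)) r m p Hm Hp).
Qed.

Hypothesis hw : idempotent w.

(** Coherence of renamings into [g_lock D]: the discard chosen for the lock does not affect the
    denotation. *)
Definition lock_sub_coherent (D : gctx P) : Prop :=
  forall G s n n' m m',
    sub var_entry (kill n G) D s m -> sub var_entry (kill n' G) D s m' ->
    dia ◃ m \o lk n G = dia ◃ m' \o lk n' G.

(** The case of [lock_sub_coherent] in which one discard is empty: by naturality [eta _ \o m] is
    [dia ◃ m \o lk 0 G]. *)
Definition kill_sub_coherent (D : gctx P) : Prop :=
  forall G d s m m', sub var_entry G D s m -> sub var_entry (kill d G) D s m' ->
    eta _ \o m = dia ◃ m' \o lk d G.

(** By [kill_split] the longer discard factors through the shorter, so the special case applies in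
    the context left by the shorter one; [mu] then removes the extra [dia]. *)
Lemma kill_lock_sub_coherent (D : gctx P) :
  kill_sub_coherent D -> lock_sub_coherent D.
Proof.
intros HD.
assert (L : forall G s n n' m m', n <= n' ->
    sub var_entry (kill n G) D s m -> sub var_entry (kill n' G) D s m' ->
    dia ◃ m \o lk n G = dia ◃ m' \o lk n' G).
{ intros G s n n' m m' L H H'.
  destruct (kill_split G L) as [d Ed].
  set (Q := fun q : {G' : gctx P & hom (ob G) (dia (ob G'))} =>
    exists p, sub var_entry (projT1 q) D s p /\
      dia ◃ m' \o lk n' G = dia ◃ p \o projT2 q).
  assert (HQ : Q (kill_at n' G)) by now exists m'.
  rewrite Ed in HQ. destruct HQ as (p & Hp & ->). simpl in *.
  pose proof (HD _ _ _ _ _ H Hp) as E.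
  rewrite !comp_assoc, mu_nat, <- (comp_assoc (mu _)), <- fmap_comp, <- E.
  now rewrite fmap_comp, !comp_assoc, mu_fmap_eta, comp_idl. }
intros G s n n' m m' H H'.
destruct (Nat.le_ge_cases n n'); [|symmetry]; eauto.
Qed.

(** The two claims are proved by simultaneous induction on the target. Idempotence enters at the
    empty context, through [dia_one_uniq], and at a lock, through [eta_mu]. *)
Lemma var_sub_coherent (D : gctx P) :
  (forall G s m m', sub var_entry G D s m -> sub var_entry G D s m' -> m = m') /\
  kill_sub_coherent D.
Proof.
induction D as [|D [IH1 IH2] A|D [IH1 IH2]|D [IH1 IH2]]; split.
- intros G s m m' _ _. exact (eq_trans (bang_uniq _) (eq_sym (bang_uniq _))).
- intros G d s m m' _ _. exact (dia_one_uniq adj hw _ _).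
- intros G s m m' (n & a & Hn & (i & Ei & Ha) & ->) (n' & a' & Hn' & (j & Ej & Ha') & ->).
  rewrite Ei in Ej. injection Ej as <-.
  rewrite (IH1 G (fun i => s (S i)) n n' Hn Hn').
  now rewrite (pack_inj (look_uniq Ha Ha')).
- intros G d s m m' (n & a & Hn & (i & Ei & Ha) & ->) (n' & a' & Hn' & (j & Ej & Ha') & ->).
  rewrite Ei in Ej. injection Ej as <-.
  (* Both renamings send the top variable to [i], which is therefore visible in [G] and in
     [kill d G]. *)
  destruct (var_sub_kill_look Ha Ha') as (p & Hp & E).
  rewrite E, comp_assoc, eta_nat, <- comp_assoc. f_equal.
  simpl. rewrite pairing_comp. f_equal.
  + apply (IH1 G (fun i => s (S i))); [exact Hn|].
    pose proof (var_sub_comp Hn' Hp) as H.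
    assert (Es : (fun i => subst tm_var (s (S i))) = fun i => s (S i)).
    { apply functional_extensionality. intros k. apply subst_id. }
    rewrite <- Es. exact H.
  + destruct (look_sub Ha' Hp) as (k & Ek & Hk). injection Ek as <-.
    exact (pack_inj (look_uniq Ha Hk)).
- intros G s m m' (n & p & H & ->) (n' & p' & H' & ->).
  exact (kill_lock_sub_coherent IH2 H H').
- intros G d s m m' (n & p & H & ->) (n' & p' & H' & ->).
  destruct (kill_compose G d n') as [k Ek].
  set (Q := fun q : {G' : gctx P & hom (ob G) (dia (ob G'))} =>
    exists p, sub var_entry (projT1 q) D s p /\
      mu _ \o dia ◃ (dia ◃ p' \o lk n' (kill d G)) \o lk d G = dia ◃ p \o projT2 q).
  assert (HQ : Q (kill_twice n' d G)).
  { exists p'. split; [exact H'|]. simpl.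
    now rewrite fmap_comp, !comp_assoc, mu_nat. }
  rewrite Ek in HQ. destruct HQ as (q & Hq & E).
  (* The left side becomes [eta] after [mu] after the right side. *)
  rewrite (kill_lock_sub_coherent IH2 H Hq). simpl in E. rewrite <- E.
  rewrite !comp_assoc. simpl. now rewrite eta_mu, comp_idl.
- exact (fun G s => IH1 G (fun i => s (S i))).
- exact (fun G d s => IH2 G d (fun i => s (S i))).
Qed.

(** * Meets of contexts *)

(* The types in [M] are those in [G]; those in [H] may differ from them, within
   [R], because a term does not determine the types of its bound variables. *)
Inductive meet (R : ty P -> ty P -> Prop) : gctx P -> gctx P -> gctx P -> Prop :=
| meet_nil : meet R g_nil g_nil g_nil
| meet_var G H M A B :
    R A B -> meet R G H M -> meet R (g_var G A) (g_var H B) (g_var M A)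
| meet_var_ghost G H M A : meet R G H M -> meet R (g_var G A) (g_ghost H) (g_ghost M)
| meet_ghost_var G H M B : meet R G H M -> meet R (g_ghost G) (g_var H B) (g_ghost M)
| meet_ghost G H M : meet R G H M -> meet R (g_ghost G) (g_ghost H) (g_ghost M)
| meet_lock G H M : meet R G H M -> meet R (g_lock G) (g_lock H) (g_lock M)
| meet_lock_l G H M : meet R G H M -> meet R (g_lock G) H (g_lock M)
| meet_lock_r G H M : meet R G H M -> meet R G (g_lock H) (g_lock M).

Definition any_ty (A B : ty P) : Prop := True.

Lemma meet_refl (G : gctx P) : meet eq G G G.
Proof. induction G; now constructor. Qed.

Lemma meet_eq (G H M : gctx P) : meet eq G H M -> meet any_ty G H M.
Proof. induction 1; econstructor; solve [eassumption | exact I]. Qed.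

Lemma meet_sym (G H M : gctx P) : meet eq G H M -> meet eq H G M.
Proof. induction 1; subst; econstructor; solve [eassumption | reflexivity]. Qed.

(* [below M G]: the context [M] gives access to no more variables than [G]. *)
Inductive below : gctx P -> gctx P -> Prop :=
| below_nil : below g_nil g_nil
| below_var M G A : below M G -> below (g_var M A) (g_var G A)
| below_ghost_var M G A : below M G -> below (g_ghost M) (g_var G A)
| below_ghost M G : below M G -> below (g_ghost M) (g_ghost G)
| below_locks M G : below M G -> below (g_lock M) (g_lock G)
| below_lock M G : below M G -> below (g_lock M) G.

Lemma below_refl (G : gctx P) : below G G.
Proof. induction G; now constructor. Qed.

Lemma meet_below R (G H M : gctx P) : meet R G H M -> below M G.
Proof. induction 1; now constructor. Qed.

Lemma below_sub (M G : gctx P) : below M G -> exists m, sub var_entry G M tm_var m.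
Proof.
induction 1 as [|M G A B [m IH]|M G A B [m IH]|M G B [m IH]|M G B [m IH]|M G B [m IH]].
- now exists (idm _).
- exists (pairing K (m \o pr1 K) (pr2 K)). exists (m \o pr1 K), (pr2 K).
  repeat split; [exact (var_sub_weaken A IH) | apply var_entry_top].
- exists (m \o pr1 K). exact (var_sub_weaken A IH).
- exists m. exact (var_sub_ghost IH).
- exists (dia ◃ m). exact (sub_lock IH).
(* A lock that only [M] has is sent to the empty discard. *)
- exists (dia ◃ m \o eta _). now exists 0, m.
Qed.

(** For [open], where the two sides may discard different amounts. A variable discarded on either
    side is a ghost of [M']; a lock discarded on one side only stays in [M'], and [below_lock]
    accounts for it when [kill l] removes it from [M]. *)
Lemma meet_kill R (G H M : gctx P) : meet R G H M -> forall n k,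
  exists M' l, meet R (kill n G) (kill k H) M' /\ below M' (kill l M).
Proof.
assert (Z : forall G H M, meet R G H M ->
  exists M' l, meet R (kill 0 G) (kill 0 H) M' /\ below M' (kill l M)).
{ intros X Y N HN. exists N, 0. split; [exact HN | apply below_refl]. }
induction 1 as [|G H M A B HR HM IH|G H M A HM IH|G H M A HM IH|G H M HM IH|G H M HM IH
  |G H M HM IH|G H M HM IH]; intros n k.
2-5: destruct n as [|n], k as [|k]; [apply Z; now constructor| | |];
  [pose proof (IH 0 k) as (M' & l & ? & ?) | pose proof (IH n 0) as (M' & l & ? & ?)
  | pose proof (IH n k) as (M' & l & ? & ?)];
  exists (g_ghost M'), (S l); split; now constructor.
- exists g_nil, 0. destruct n, k; split; constructor.
- destruct n as [|n], k as [|k]; [apply Z; now constructor| | |].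
  + destruct (IH 0 k) as (M' & l & ? & ?). exists (g_lock M'), (S l).
    split; [now apply meet_lock_l | now apply below_lock].
  + destruct (IH n 0) as (M' & l & ? & ?). exists (g_lock M'), (S l).
    split; [now apply meet_lock_r | now apply below_lock].
  + destruct (IH n k) as (M' & l & ? & ?). now exists M', (S l).
- destruct n as [|n].
  + destruct (IH 0 k) as (M' & l & ? & ?). exists (g_lock M'), (S l).
    split; [now apply meet_lock_l | now apply below_lock].
  + destruct (IH n k) as (M' & l & ? & ?). now exists M', (S l).
- destruct k as [|k].
  + destruct (IH n 0) as (M' & l & ? & ?). exists (g_lock M'), (S l).
    split; [now apply meet_lock_r | now apply below_lock].
  + destruct (IH n k) as (M' & l & ? & ?). now exists M', (S l).
Qed.

Lemma look_meet (G H M : gctx P) (i : nat) (A B : ty P) (f : hom (ob G) (dty A))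
  (g : hom (ob H) (dty B)) :
  meet any_ty G H M -> look G i f -> look H i g -> exists h, look M i (A := A) h.
Proof.
intros HM; revert i f g.
induction HM as [|G H M D D' _ HM IH|G H M D HM IH|G H M D HM IH|G H M HM IH|G H M HM IH
  |G H M HM IH|G H M HM IH]; intros i f g Hf Hg; try easy; destruct i as [|i]; try easy.
- simpl in Hf. destruct (pack_ty Hf). now exists (pr2 K).
- destruct Hf as (f' & Hf & _), Hg as (g' & Hg & _).
  destruct (IH i f' g' Hf Hg) as [h Hh]. exists (h \o pr1 K). now exists h.
- destruct Hf as (f' & Hf & _). exact (IH i f' g Hf Hg).
- destruct Hg as (g' & Hg & _). exact (IH i f g' Hf Hg).
- exact (IH i f g Hf Hg).
Qed.

Lemma interp_below (M G : gctx P) (t : tm) (A : ty P) (f : hom (ob M) (dty A)) :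
  below M G -> interp t M f -> exists g, interp t G (A := A) g.
Proof.
intros HM H. destruct (below_sub HM) as [m Hm]. exists (f \o m).
rewrite <- (subst_id t). exact (interp_var_subst H Hm).
Qed.

(* The types in the derivation over [M] are taken from the one over [G]; the
   other one only tells how far each [open] may go back. *)
Lemma interp_meet (t : tm) (G H M : gctx P) (A B : ty P) (f : hom (ob G) (dty A))
  (g : hom (ob H) (dty B)) :
  meet any_ty G H M -> interp t G f -> interp t H g -> exists h, interp t M (A := A) h.
Proof.
revert G H M A B f g; induction t; intros G H M A B f g HM Hf Hg.
- exact (look_meet HM Hf Hg).
- destruct A; try easy. now exists (bang K _).
- destruct A; try easy. destruct B; try easy.
  destruct Hf as (f1 & f2 & Hf1 & Hf2 & _), Hg as (g1 & g2 & Hg1 & Hg2 & _).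
  destruct (IHt1 _ _ _ _ _ _ _ HM Hf1 Hg1) as [h1 H1].
  destruct (IHt2 _ _ _ _ _ _ _ HM Hf2 Hg2) as [h2 H2].
  exists (pairing K h1 h2). now exists h1, h2.
- destruct Hf as (D & f' & Hf & _), Hg as (D' & g' & Hg & _).
  destruct (IHt _ _ _ _ _ _ _ HM Hf Hg) as [h Hh]. exists (pr1 K \o h). now exists D, h.
- destruct Hf as (D & f' & Hf & _), Hg as (D' & g' & Hg & _).
  destruct (IHt _ _ _ _ _ _ _ HM Hf Hg) as [h Hh]. exists (pr2 K \o h). now exists D, h.
- destruct A; try easy. destruct B; try easy.
  destruct Hf as (f' & Hf & _), Hg as (g' & Hg & _).
  destruct (IHt _ _ _ _ _ _ _ (meet_var (A := A1) (B := B1) I HM) Hf Hg) as [h Hh].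
  exists (curry h). now exists h.
- destruct Hf as (D & f1 & f2 & Hf1 & Hf2 & _), Hg as (D' & g1 & g2 & Hg1 & Hg2 & _).
  destruct (IHt1 _ _ _ _ _ _ _ HM Hf1 Hg1) as [h1 H1].
  destruct (IHt2 _ _ _ _ _ _ _ HM Hf2 Hg2) as [h2 H2].
  exists (ev K \o pairing K h1 h2). now exists D, h1, h2.
- destruct A; try easy. destruct B; try easy.
  destruct Hf as (f' & Hf & _), Hg as (g' & Hg & _).
  destruct (IHt _ _ _ _ _ _ _ (meet_lock HM) Hf Hg) as [h Hh].
  exists (transpose adj h). now exists h.
- destruct Hf as (n & f' & Hf & _), Hg as (k & g' & Hg & _).
  destruct (meet_kill HM n k) as (M' & l & HM' & HB).
  destruct (IHt _ _ _ _ _ _ _ HM' Hf Hg) as [h Hh].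
  destruct (interp_below HB Hh) as [h' Hh'].
  eexists. exists l, h'. now split.
Qed.

(** * Uniqueness *)

Lemma neutral_normal_uniq :
  (forall t, neutral t -> forall G A B (f : hom (ob G) (dty A)) (g : hom (ob G) (dty B)),
     interp t G f -> interp t G g -> pack f = pack g) /\
  (forall t, normal t -> forall G A (f g : hom (ob G) (dty A)),
     interp t G f -> interp t G g -> f = g).
Proof.
apply (neutral_normal_ind
  (P := fun t _ => forall G A B (f : hom (ob G) (dty A)) (g : hom (ob G) (dty B)),
     interp t G f -> interp t G g -> pack f = pack g)
  (P0 := fun t _ => forall G A (f g : hom (ob G) (dty A)),
     interp t G f -> interp t G g -> f = g)).
- intros i G A B f g Hf Hg. exact (look_uniq Hf Hg).
- intros t _ IH G A B f g (D & f' & Hf & ->) (D' & g' & Hg & ->).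
  pose proof (IH _ _ _ _ _ Hf Hg) as E.
  pose proof (pack_ty E) as ET. injection ET as <- <-. now rewrite (pack_inj E).
- intros t _ IH G A B f g (D & f' & Hf & ->) (D' & g' & Hg & ->).
  pose proof (IH _ _ _ _ _ Hf Hg) as E.
  pose proof (pack_ty E) as ET. injection ET as <- <-. now rewrite (pack_inj E).
- intros t u _ IHt _ IHu G A B f g (D & f' & a & Hf & Ha & ->) (D' & g' & b & Hg & Hb & ->).
  pose proof (IHt _ _ _ _ _ Hf Hg) as E.
  (* The neutral head fixes the type of the argument, so the normal [u] is compared at a single
     type. *)
  pose proof (pack_ty E) as ET. injection ET as <- <-.
  now rewrite (pack_inj E), (IHu _ _ _ _ Ha Hb).
- intros t _ IH G A B f g (n & f' & Hf & ->) (k & g' & Hg & ->).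
  destruct (meet_kill (meet_refl G) n k) as (M & _ & HM & _).
  destruct (interp_meet (meet_eq HM) Hf Hg) as [h Hh].
  (* Since [interp_meet] takes the type from its first derivation, it is applied both ways; the
     induction hypothesis over [M] then identifies the two types. *)
  destruct (interp_meet (meet_eq (meet_sym HM)) Hg Hf) as [h' Hh'].
  pose proof (IH _ _ _ _ _ Hh Hh') as E.
  pose proof (pack_ty E) as ET. injection ET as <-. apply pack_inj in E as <-.
  destruct (below_sub (meet_below HM)) as [p Hp].
  destruct (below_sub (meet_below (meet_sym HM))) as [q Hq].
  (* Renaming [h] back along [p] interprets [t] in the same context as [f'], so the induction
     hypothesis applies again. *)
  assert (Ef : f' = h \o p).
  { apply pack_inj. apply (IH _ _ _ _ _ Hf).
    rewrite <- (subst_id t). exact (interp_var_subst Hh Hp). }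
  assert (Eg : g' = h \o q).
  { apply pack_inj. apply (IH _ _ _ _ _ Hg).
    rewrite <- (subst_id t). exact (interp_var_subst Hh Hq). }
  rewrite Ef, Eg, !fmap_comp, <- !comp_assoc.
  now rewrite (kill_lock_sub_coherent (proj2 (var_sub_coherent M)) Hp Hq).
- intros t _ IH G A f g Hf Hg. exact (pack_inj (IH _ _ _ _ _ Hf Hg)).
- intros G A f g Hf Hg. destruct A; try easy.
  exact (eq_trans (bang_uniq _) (eq_sym (bang_uniq _))).
- intros t u _ IHt _ IHu G A f g Hf Hg. destruct A; try easy.
  destruct Hf as (f1 & f2 & Hf1 & Hf2 & ->), Hg as (g1 & g2 & Hg1 & Hg2 & ->).
  now rewrite (IHt _ _ _ _ Hf1 Hg1), (IHu _ _ _ _ Hf2 Hg2).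
- intros t _ IH G A f g Hf Hg. destruct A; try easy.
  destruct Hf as (f' & Hf & ->), Hg as (g' & Hg & ->).
  now rewrite (IH _ _ _ _ Hf Hg).
- intros t _ IH G A f g Hf Hg. destruct A; try easy.
  destruct Hf as (f' & Hf & ->), Hg as (g' & Hg & ->).
  now rewrite (IH _ _ _ _ Hf Hg).
Qed.

(** Both interpretations are carried along one reduction to the same normal form. *)
Lemma interp_uniq (t : tm) (G : gctx P) (A : ty P) (f g : hom (ob G) (dty A)) :
  interp t G f -> interp t G g -> f = g.
Proof.
intros Hf Hg. destruct (interp_normalizes Hf) as (n & Hn & R).
exact (proj2 neutral_normal_uniq n Hn _ _ _ _ (red_interp R Hf) (red_interp R Hg)).
Qed.

(** * Derivations *)

Fixpoint ghostify (Γ : ctx P) : gctx P :=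
  match Γ with
  | ctx_nil => g_nil
  | ctx_var Γ A => g_var (ghostify Γ) A
  | ctx_lock Γ => g_lock (ghostify Γ)
  end.

(* The two objects are equal, but not by conversion. *)
Fixpoint ctx_ob (Γ : ctx P) : hom (den_ctx_obj K dia box rho Γ) (ob (ghostify Γ)) :=
  match Γ with
  | ctx_nil => idm (one K)
  | ctx_var Γ A => pairing K (ctx_ob Γ \o pr1 K) (pr2 K)
  | ctx_lock Γ => dia ◃ ctx_ob Γ
  end.

(** Matches the [open] rule with [kill]. The witness [n] counts the entries of [Γ'], locks included,
    and [g] is [f] read at the killed context, whose object agrees with that of [Γ]. *)
Lemma interp_app (Γ Γ' : ctx P) (t : tm) (A : ty P) (f : hom (ob (ghostify Γ)) (dty A)) :
  interp t (ghostify Γ) f ->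
  exists n g,
    interp (A := A) (ren (fun i => i + nvars Γ') t) (kill n (ghostify (ctx_app Γ Γ'))) g /\
    dia ◃ g \o lk n (ghostify (ctx_app Γ Γ')) \o ctx_ob (ctx_app Γ Γ') =
    dia ◃ (f \o ctx_ob Γ) \o lock_replace K adj w rho Γ' (den_ctx_obj K dia box rho Γ)
      \o idto (den_ctx_app K dia box rho Γ Γ' (one K)).
Proof.
intros H. induction Γ' as [|Γ' (n & g & IH & E) B|Γ' (n & g & IH & E)]; simpl.
- exists 0, f. split.
  + replace (ren _ t) with t; [exact H|].
    rewrite <- subst_var, <- (subst_id t) at 1. f_equal.
    apply functional_extensionality. intros i. simpl. f_equal. lia.
  + simpl. rewrite comp_idr, fmap_comp, <- !comp_assoc. f_equal. symmetry. apply eta_nat.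
- exists (S n), g. split.
  + apply interp_ghost in IH. rewrite ren_ren in IH.
    replace (fun i => i + S (nvars Γ')) with (fun i => S (i + nvars Γ')); [exact IH|].
    apply functional_extensionality. intros i. lia.
  + simpl.
    rewrite idto_prod.
    rewrite <- !comp_assoc, !pr1_pairing, !comp_assoc.
    now rewrite E.
- exists (S n), g. split; [exact IH|]. unfold den_ctx_obj in *. simpl.
  rewrite (idto_fmap dia (den_ctx_app K dia box rho Γ Γ' (one K))).
  rewrite !comp_assoc, !mu_nat, <- !comp_assoc. f_equal.
  now rewrite !comp_assoc, <- !fmap_comp, E.
Qed.

Lemma look_app (Γ Γ' : ctx P) (A : ty P) (h : lockfree Γ') :
  exists f, look (ghostify (ctx_app (ctx_var Γ A) Γ')) (nvars Γ') (A := A) f /\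
    pr2 K \o lockfree_proj K dia box rho (den_ctx_obj K dia box rho (ctx_var Γ A)) h
      \o idto (den_ctx_app K dia box rho (ctx_var Γ A) Γ' (one K)) =
    f \o ctx_ob (ctx_app (ctx_var Γ A) Γ').
Proof.
induction Γ' as [|Γ' IH B|Γ' IH]; simpl in *.
- exists (pr2 K). split; [reflexivity|]. now rewrite pr2_pairing, !comp_idr.
- destruct (IH h) as (f & Hf & E). exists (f \o pr1 K). split; [now exists f|].
  unfold den_ctx_obj in *. simpl in *. rewrite idto_prod.
  rewrite <- !comp_assoc, !pr1_pairing, !comp_assoc.
  exact (f_equal (fun x => x \o pr1 K) E).
- destruct h.
Qed.

(** The factor [ctx_ob Γ] does not depend on the derivation, so uniqueness for [interp] gives
    uniqueness for [den]. *)
Lemma deriv_interp (Γ : ctx P) (t : tm) (A : ty P) (D : deriv Γ t A) :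
  exists f, interp t (ghostify Γ) f /\ den K adj w rho D = f \o ctx_ob Γ.
Proof.
induction D as [Γ A Γ' h|Γ|Γ t u A B D1 (f & Hf & E1) D2 (g & Hg & E2)
  |Γ t A B D (f & Hf & E)|Γ t A B D (f & Hf & E)|Γ t A B D (f & Hf & E)
  |Γ t u A B D1 (f & Hf & E1) D2 (g & Hg & E2)|Γ t A D (f & Hf & E)
  |Γ Γ' t A D (f & Hf & E)]; simpl.
- exact (look_app Γ A h).
- exists (bang K _). split; [exact I|]. symmetry. apply bang_uniq.
- exists (pairing K f g). split; [now exists f, g|].
  now rewrite E1, E2, pairing_comp.
- exists (pr1 K \o f). split; [now exists B, f|]. now rewrite E, comp_assoc.
- exists (pr2 K \o f). split; [now exists A, f|]. now rewrite E, comp_assoc.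
- exists (curry f). split; [now exists f|]. now rewrite E, curry_comp.
- exists (ev K \o pairing K f g). split; [now exists A, f, g|].
  now rewrite E1, E2, <- comp_assoc, pairing_comp.
- exists (transpose adj f). split; [now exists f|]. rewrite E.
  exact (transpose_fmap adj f (ctx_ob Γ)).
- destruct (interp_app Γ' Hf) as (n & g & Hg & E').
  exists (counit_at adj (dty A) \o dia ◃ g \o lk n (ghostify (ctx_app Γ Γ'))). split.
  + rewrite lift_ren. now exists n, g.
  + rewrite E. rewrite <- !comp_assoc, (comp_assoc (dia ◃ g)), E'.
    now rewrite <- !comp_assoc.
Qed.

End Interpretation.

Theorem theorem8 (C : category) (K : cartesian_closed C)
  (dia box : functor C C) (adj : adjunction dia box)
  (w : comonad box) (hw : idempotent w)
  (P : Type) (rho : P -> C)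
  (Γ : ctx P) (t : tm) (A : ty P) (D1 D2 : deriv Γ t A) :
  den K adj w rho D1 = den K adj w rho D2.
Proof.
destruct (deriv_interp K adj w rho D1) as (f & Hf & ->).
destruct (deriv_interp K adj w rho D2) as (g & Hg & ->).
now rewrite (interp_uniq hw Hf Hg).
Qed.
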